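(* Consider the closed-loop system $x(k+1)=A_Gx(k)+B_G\pi(x(k))$, where $A_G\in\mathbb{R}^{n_x\times n_x}$, $B_G\in\mathbb{R}^{n_x\times n_u}$ are (unknown) constant matrices and $\pi$ is the neural network controller described in the context, with $\pi(0)=0$. Let $U_0\in\mathbb{R}^{n_u\times K}$, $X_0,X_1\in\mathbb{R}^{n_x\times K}$ be the data matrices described in the context (so $X_1=A_GX_0+B_GU_0$), and assume $$\mathrm{rank}\begin{bmatrix}U_0\\ X_0\end{bmatrix}=n_x+n_u,\qquad \mathrm{rank}(X_1)=n_x .$$ Let $\alpha_\phi,\beta_\phi,v_*\in\mathbb{R}^{n_\phi}$ be given with $\alpha_\phi\le\beta_\phi$ (elementwise), and let $w_*:=\phi(v_* )$. Assume that $\phi$ satisfies elementwise the offset sector $[\alpha_\phi,\beta_\phi]$ centered on the point $(v_*,w_* )$. Let $\tilde N_{ux},\tilde N_{uz},\tilde N_{vx},\tilde N_{vz}$ be the loop-transformed network matrices defined in the context. If there exist $L_1\in\mathbb{R}^{K\times n_x}$, $L_2\in\mathbb{R}^{K\times n_\phi}$, a symmetric positive definite matrix $Q_1\in\mathbb{R}^{n_x\times n_x}$ and a diagonal positive definite matrix $Q_2\in\mathbb{R}^{n_\phi\times n_\phi}$ such that $$\begin{bmatrix} Q_1&0&L_1^\top X_1^\top&Q_1\tilde N_{vx}^\top\\ 0&Q_2&L_2^\top X_1^\top&Q_2\tilde N_{vz}^\top\\ X_1L_1&X_1L_2&Q_1&0\\ \tilde N_{vx}Q_1&\tilde N_{vz}Q_2&0&Q_2\end{bmatrix}\succ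 0$$ and $$\begin{bmatrix}\tilde N_{ux}Q_1\\ Q_1\end{bmatrix}=\begin{bmatrix}U_0\\ X_0\end{bmatrix}L_1,\qquad \begin{bmatrix}\tilde N_{uz}Q_2\\ 0\end{bmatrix}=\begin{bmatrix}U_0\\ X_0\end{bmatrix}L_2,$$ then the closed-loop system is asymptotically stable around $x_*=0$.
   Context: Neural network controller. $\pi:\mathbb{R}^{n_x}\to\mathbb{R}^{n_u}$ is a feed-forward fully connected network with $l$ hidden layers: for input $x$, $w^0=x$, $v^i=W^iw^{i-1}+b^i$ and $w^i=\phi^i(v^i)$ for $i=1,\dots,l$, and $\pi(x)=W^{l+1}w^l+b^{l+1}$. Here $W^i\in\mathbb{R}^{n_i\times n_{i-1}}$, $b^i\in\mathbb{R}^{n_i}$, $n_0=n_x$, $n_{l+1}=n_u$, and $\phi^i(v^i)=[\varphi(v^i_1),\dots,\varphi(v^i_{n_i})]^\top$ for a scalar activation function $\varphi:\mathbb{R}\to\mathbb{R}$. It is assumed throughout that $\pi(0)=0$. Put $n_\phi=n_1+\dots+n_l$, let $v_\phi,w_\phi\in\mathbb{R}^{n_\phi}$ be the stacked vectors of all $v^i$, respectively all $w^i$ ($i=1,\dots,l$), and let $\phi:\mathbb{R}^{n_\phi}\to\mathbb{R}^{n_\phi}$ apply $\varphi$ to each entry, so $w_\phi=\phi(v_\phi)$. Data. For the open-loop system $x(k+1)=A_Gx(k)+B_Gu(k)$, noise-free data are collected: $U_0=[u(0)\ u(1)\ \cdots\ u(K-1)]$, $X_0=[x(0)\ x(1)\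 \cdots\ x(K-1)]$, $X_1=[x(1)\ x(2)\ \cdots\ x(K)]$. Offset sector. For $\alpha\le\beta$ and $\nu_*\in\mathbb{R}$, $\varphi$ satisfies the offset sector $[\alpha,\beta]$ around $(\nu_*,\varphi(\nu_* ))$ if $\big((\varphi(\nu_* )-\varphi(\nu))-\alpha(\nu_*-\nu)\big)\big(\beta(\nu_*-\nu)-(\varphi(\nu_* )-\varphi(\nu))\big)\ge 0$ for all $\nu\in\mathbb{R}$. $\phi$ satisfies elementwise the offset sector $[\alpha_\phi,\beta_\phi]$ centered on $(v_*,w_* )$ if for each $i=1,\dots,n_\phi$, the $i$-th component function satisfies the offset sector $[\alpha_\phi^i,\beta_\phi^i]$ around $(v_*^i,\varphi(v_*^i))$. Network matrices. $N_{ux}=0\in\mathbb{R}^{n_u\times n_x}$; $N_{uw}=[0\ \cdots\ 0\ W^{l+1}]\in\mathbb{R}^{n_u\times n_\phi}$; $N_{vx}=[(W^1)^\top\ 0\ \cdots\ 0]^\top\in\mathbb{R}^{n_\phi\times n_x}$; $N_{vw}\in\mathbb{R}^{n_\phi\times n_\phi}$ is the block matrix (block sizes $n_1,\dots,n_l$) whose only nonzero blocks are the subdiagonal blocks: the block in position $(i,i-1)$ is $W^i$ for $i=2,\dots,l$. With $A_\phi=\mathrm{diag}(\alpha_\phi)$, $B_\phi=\mathrm{diag}(\beta_\phi)$, set $C_1=N_{uw}\tfrac{B_\phi-A_\phi}{2}$, $C_2=N_{uw}\tfrac{A_\phi+B_\phi}{2}$, $C_3=N_{vw}\tfrac{B_\phi-A_\phi}{2}$,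 $C_4=N_{vw}\tfrac{A_\phi+B_\phi}{2}$, and $\tilde N_{ux}=N_{ux}+C_2(I-C_4)^{-1}N_{vx}$, $\tilde N_{uz}=C_1+C_2(I-C_4)^{-1}C_3$, $\tilde N_{vx}=(I-C_4)^{-1}N_{vx}$, $\tilde N_{vz}=(I-C_4)^{-1}C_3$. $M\succ0$ means $M$ is symmetric positive definite.
   Formalization: The formal theorem requires v_* to be the stacked vector of pre-activations of the network at the equilibrium x_*=0 (and l≥1); for an arbitrary given v_* the claim is false, since a sector around an unrelated point does not control the behaviour near 0. *)

(* Defs.v *)
(* MathComp and MathComp-Analysis. *)
From HB Require Import structures.
From mathcomp Require Import all_boot all_order all_algebra.
From mathcomp Require Import all_classical all_reals all_analysis.

Set Implicit Arguments.
Unset Strict Implicit.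
Unset Printing Implicit Defensive.

Import Order.TTheory GRing.Theory Num.Theory.
Import numFieldNormedType.Exports.

Local Open Scope classical_set_scope.
Local Open Scope ring_scope.

(* Networks with [l] hidden layers. Layer widths are [n 0, ..., n l.+1]; [n 0]
   is the input and [n l.+1] the output dimension. [W i] and [b i] map layer [i]
   to layer [i.+1], so they are the usual W^{i+1} and b^{i+1}. Only the indices
   [i <= l] matter. *)

Fixpoint layer_out (R : realType) (n : nat -> nat) (phi : R -> R)
    (W : forall i, 'M[R]_(n i.+1, n i)) (b : forall i, 'cV[R]_(n i.+1))
    (x : 'cV[R]_(n 0%N)) (i : nat) : 'cV[R]_(n i) :=
  match i with
  | 0 => x
  | j.+1 => map_mx phi (W j *m layer_out phi W b x j + b j)
  end.

(* The pre-activation v^{i+1}. *)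
Definition layer_in (R : realType) (n : nat -> nat) (phi : R -> R)
    (W : forall i, 'M[R]_(n i.+1, n i)) (b : forall i, 'cV[R]_(n i.+1))
    (x : 'cV[R]_(n 0%N)) (i : nat) : 'cV[R]_(n i.+1) :=
  W i *m layer_out phi W b x i + b i.

(* There is no activation on the output layer. *)
Definition network (R : realType) (n : nat -> nat) (l : nat) (phi : R -> R)
    (W : forall i, 'M[R]_(n i.+1, n i)) (b : forall i, 'cV[R]_(n i.+1))
    (x : 'cV[R]_(n 0%N)) : 'cV[R]_(n l.+1) :=
  layer_in phi W b x l.

Definition nphi (n : nat -> nat) (l : nat) : nat := (\sum_(i < l) n i.+1)%N.

Definition stacked_in (R : realType) (n : nat -> nat) (l : nat) (phi : R -> R)
    (W : forall i, 'M[R]_(n i.+1, n i)) (b : forall i, 'cV[R]_(n i.+1))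
    (x : 'cV[R]_(n 0%N)) : 'cV[R]_(nphi n l) :=
  \mxcol_(i < l) layer_in phi W b x i.

(* In the block matrices below, [conform_mx 0] only transports along the equality
   of indices tested by the enclosing conditional; its default value 0 is
   therefore never used. *)

Definition Nux (R : realType) (n : nat -> nat) (l : nat) :
    'M[R]_(n l.+1, n 0%N) := 0.

Definition Nuw (R : realType) (n : nat -> nat) (l : nat)
    (W : forall i, 'M[R]_(n i.+1, n i)) : 'M[R]_(n l.+1, nphi n l) :=
  \mxrow_(j < l) (if j.+1 == l then conform_mx 0 (W l)
                  else 0 : 'M[R]_(n l.+1, n j.+1)).

Definition Nvx (R : realType) (n : nat -> nat) (l : nat)
    (W : forall i, 'M[R]_(n i.+1, n i)) : 'M[R]_(nphi n l, n 0%N) :=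
  \mxcol_(i < l) (if i == 0 :> nat then conform_mx 0 (W i)
                  else 0 : 'M[R]_(n i.+1, n 0%N)).

Definition Nvw (R : realType) (n : nat -> nat) (l : nat)
    (W : forall i, 'M[R]_(n i.+1, n i)) : 'M[R]_(nphi n l, nphi n l) :=
  \mxblock_(i < l, j < l) (if i == j.+1 :> nat then conform_mx 0 (W i)
                           else 0 : 'M[R]_(n i.+1, n j.+1)).

Definition half_diff (R : realType) (m : nat) (alpha beta : 'cV[R]_m) :
    'M[R]_m := 2^-1 *: (diag_mx beta^T - diag_mx alpha^T).

Definition half_sum (R : realType) (m : nat) (alpha beta : 'cV[R]_m) :
    'M[R]_m := 2^-1 *: (diag_mx alpha^T + diag_mx beta^T).

Definition C1 (R : realType) (n : nat -> nat) (l : nat)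
    (W : forall i, 'M[R]_(n i.+1, n i)) (alpha beta : 'cV[R]_(nphi n l)) :
    'M[R]_(n l.+1, nphi n l) := Nuw l W *m half_diff alpha beta.

Definition C2 (R : realType) (n : nat -> nat) (l : nat)
    (W : forall i, 'M[R]_(n i.+1, n i)) (alpha beta : 'cV[R]_(nphi n l)) :
    'M[R]_(n l.+1, nphi n l) := Nuw l W *m half_sum alpha beta.

Definition C3 (R : realType) (n : nat -> nat) (l : nat)
    (W : forall i, 'M[R]_(n i.+1, n i)) (alpha beta : 'cV[R]_(nphi n l)) :
    'M[R]_(nphi n l) := Nvw l W *m half_diff alpha beta.

Definition C4 (R : realType) (n : nat -> nat) (l : nat)
    (W : forall i, 'M[R]_(n i.+1, n i)) (alpha beta : 'cV[R]_(nphi n l)) :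
    'M[R]_(nphi n l) := Nvw l W *m half_sum alpha beta.

(* [C4] is strictly block lower triangular, so [1%:M - C4] is invertible and
   [invmx] is the true inverse below. *)

Definition Nux_t (R : realType) (n : nat -> nat) (l : nat)
    (W : forall i, 'M[R]_(n i.+1, n i)) (alpha beta : 'cV[R]_(nphi n l)) :
    'M[R]_(n l.+1, n 0%N) :=
  Nux R n l + C2 W alpha beta *m invmx (1%:M - C4 W alpha beta) *m Nvx l W.

Definition Nuz_t (R : realType) (n : nat -> nat) (l : nat)
    (W : forall i, 'M[R]_(n i.+1, n i)) (alpha beta : 'cV[R]_(nphi n l)) :
    'M[R]_(n l.+1, nphi n l) :=
  C1 W alpha beta
  + C2 W alpha beta *m invmx (1%:M - C4 W alpha beta) *m C3 W alpha beta.

Definition Nvx_t (R : realType) (n : nat -> nat) (l : nat)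
    (W : forall i, 'M[R]_(n i.+1, n i)) (alpha beta : 'cV[R]_(nphi n l)) :
    'M[R]_(nphi n l, n 0%N) :=
  invmx (1%:M - C4 W alpha beta) *m Nvx l W.

Definition Nvz_t (R : realType) (n : nat -> nat) (l : nat)
    (W : forall i, 'M[R]_(n i.+1, n i)) (alpha beta : 'cV[R]_(nphi n l)) :
    'M[R]_(nphi n l) :=
  invmx (1%:M - C4 W alpha beta) *m C3 W alpha beta.

Definition offset_sector (R : realType) (phi : R -> R) (a b nu0 : R) : Prop :=
  forall nu, 0 <= ((phi nu0 - phi nu) - a * (nu0 - nu))
                  * (b * (nu0 - nu) - (phi nu0 - phi nu)).

(* The centre is the point [(vs, map_mx phi vs)]. *)
Definition elementwise_offset_sector (R : realType) (m : nat) (phi : R -> R)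
    (alpha beta vs : 'cV[R]_m) : Prop :=
  forall i, offset_sector phi (alpha i 0) (beta i 0) (vs i 0).

Definition posdefmx (R : realType) (m : nat) (M : 'M[R]_m) : Prop :=
  M^T = M /\ forall x : 'cV[R]_m, x != 0 -> 0 < (x^T *m M *m x) 0 0.

(* The columns are [s k, s k.+1, ..., s (k + K - 1)]. *)
Definition data_mx (R : realType) (m : nat) (s : nat -> 'cV[R]_m) (k K : nat) :
    'M[R]_(m, K) := \matrix_(i < m, j < K) s (k + j)%N i 0.

(* Lyapunov stability together with local attractivity. The norm of
   MathComp-Analysis on matrices is the sup norm; on a finite-dimensional space
   the notion does not depend on this choice. *)
Definition asymptotically_stable (R : realType) (m : nat)
    (f : 'cV[R]_m -> 'cV[R]_m) (xs : 'cV[R]_m) : Prop :=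
  (forall e : R, 0 < e -> exists2 d : R, 0 < d &
     forall x0, `|x0 - xs| < d -> forall k, `|iter k f x0 - xs| < e) /\
  (exists2 d : R, 0 < d &
     forall x0, `|x0 - xs| < d -> iter k f x0 @[k --> \oo] --> xs).

(* Main.v *)
Require Import Defs.
From HB Require Import structures.
From mathcomp Require Import all_boot all_order all_algebra.
From mathcomp Require Import all_classical all_reals all_analysis.
From mathcomp Require Import ring lra.

Set Implicit Arguments.
Unset Strict Implicit.
Unset Printing Implicit Defensive.

Import Order.TTheory GRing.Theory Num.Theory.
Import numFieldNormedType.Exports.

Local Open Scope classical_set_scope.
Local Open Scope ring_scope.

(** The Lyapunov function is [V x = x^T Q1^-1 x]. Let [dv] and [dw] be the
    deviations of the stacked pre-activations and activations from their values
    at the equilibrium 0. The layer equations read [dv = Nvx x + Nvw dw] and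
    [pi x = Nuw dw], by [stacked_in_sub] and [network_sub]. The sector condition
    allows one to write [dw = (beta - alpha)/2 z + (alpha + beta)/2 dv] for
    some [z] with [z_i^2 <= dv_i^2] in every coordinate
    ([elementwise_sector_normalized]). Solving for [dv], which is possible since
    [1 - C4] is invertible ([loop_unitmx]), gives
    [dv = Nvx_t x + Nvz_t z] and [pi x = Nux_t x + Nuz_t z]
    ([loop_transformation]).

    The data equations turn [X1 L1 Q1^-1] and [X1 L2 Q2^-1] into
    [A + B Nux_t] and [B Nuz_t], so the successor of [x] is
    [x' = X1 L1 Q1^-1 x + X1 L2 Q2^-1 z]. Evaluating the LMI at
    [(Q1^-1 x, Q2^-1 z, - Q1^-1 x', - Q2^-1 dv)] yields
    [V x - V x' + (z^T Q2^-1 z - dv^T Q2^-1 dv)]. As [Q2] is diagonal and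
    positive, the bracket is nonpositive, so [V x' < V x] unless [x = 0].

    The activation function need not be continuous away from the centre of the
    sector, so strict decrease alone does not give convergence. A uniform rate
    comes from the LMI itself: a positive definite form dominates every other
    quadratic form up to a constant ([qform_dominated]), which improves the
    inequality to [V x' <= r V x] with a fixed [r < 1] ([lmi_contraction]). This
    contraction gives asymptotic stability
    ([lyapunov_asymptotically_stable]). *)

(** * Quadratic forms *)

(** The value of the quadratic form with matrix [M] at the column vector [x]. *)
Definition qform (R : realType) (m : nat) (M : 'M[R]_m) (x : 'cV[R]_m) : R :=
  (x^T *m M *m x) 0 0.

Lemma sqr_norm_le (R : realType) (m : nat) (y : 'cV[R]_m) (c : R) :
  0 <= c -> (forall i, y i 0 ^+ 2 <= c) -> `|y| ^+ 2 <= c.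
Proof.
move=> c0 yc; have [->|y0] := eqVneq `|y| 0; first by rewrite expr0n.
have [[i j] /= ->] : exists i, `|y| = `|y i.1 i.2| by exact: mx_norm_neq0 y0.
by rewrite (ord1 j) real_normK ?num_real.
Qed.

Lemma norm_coord_le (R : realType) (m : nat) (y : 'cV[R]_m) (i : 'I_m) :
  `|y i 0| <= `|y|.
Proof.
rewrite [`|y|]mx_normrE; exact: (le_bigmax _ (fun ij => `|y ij.1 ij.2|) (i, 0)).
Qed.

Lemma qform_upper (R : realType) (m : nat) (M : 'M[R]_m) :
  exists2 c : R, 0 < c & forall y, qform M y <= c * `|y| ^+ 2.
Proof.
exists (1 + \sum_i \sum_j `|M i j|) => [|y].
  by rewrite ltr_pwDl ?ltr01// sumr_ge0// => i _; rewrite sumr_ge0.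
apply: (@le_trans _ _ ((\sum_i \sum_j `|M i j|) * `|y| ^+ 2)); last first.
  by rewrite ler_wpM2r ?sqr_ge0// lerDr.
rewrite /qform mxE exchange_big mulr_suml; apply: ler_sum => j _ /=.
rewrite mxE !mulr_suml; apply: ler_sum => i _; rewrite !mxE.
rewrite (le_trans (ler_norm _))// !normrM mulrAC mulrC expr2.
by rewrite ler_wpM2l// ler_pM// norm_coord_le.
Qed.

Lemma posdefmx_unit (R : realType) (m : nat) (M : 'M[R]_m) :
  posdefmx M -> M \in unitmx.
Proof.
move=> [_ Mpos]; rewrite -row_free_unit; apply: inj_row_free => v vM.
apply: trmx_inj; rewrite trmx0; apply/eqP; apply/negP => /negP /Mpos.
by rewrite trmxK vM mul0mx mxE ltxx.
Qed.

Lemma posdefmx_qform_ge0 (R : realType) (m : nat) (M : 'M[R]_m) (y : 'cV[R]_m) :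
  posdefmx M -> 0 <= qform M y.
Proof.
move=> [_ Mpos]; have [->|/Mpos/ltW//] := eqVneq y 0.
by rewrite /qform mulmx0 mxE.
Qed.

Lemma qform_mul (R : realType) (m : nat) (M P : 'M[R]_m) (y : 'cV[R]_m) :
  qform M (P *m y) = qform (P^T *m M *m P) y.
Proof. by rewrite /qform trmx_mul !mulmxA. Qed.

Lemma posdefmx_inv (R : realType) (m : nat) (M : 'M[R]_m) :
  posdefmx M -> posdefmx (invmx M).
Proof.
move=> Mpd; have Mu := posdefmx_unit Mpd; case: Mpd => Msym Mpos.
have Nsym : (invmx M)^T = invmx M by rewrite trmx_inv Msym.
split=> // x x0.
have -> : x^T *m invmx M *m x = (invmx M *m x)^T *m M *m (invmx M *m x).
  by rewrite trmx_mul Nsym !mulmxA mulmxKV.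
apply: Mpos; apply: contra x0 => /eqP Nx.
by rewrite -(mulKVmx Mu x) Nx mulmx0.
Qed.

(** Cauchy-Schwarz for the inner product of [M], applied to [y] and to the
    [i]-th column of the inverse of [M], whose inner product is [y i 0]. *)
Lemma sqr_coord_le_qform (R : realType) (m : nat) (M : 'M[R]_m)
    (y : 'cV[R]_m) (i : 'I_m) :
  posdefmx M -> y i 0 ^+ 2 <= invmx M i i * qform M y.
Proof.
move=> Mpd; have Mu := posdefmx_unit Mpd; have Msym := Mpd.1.
pose e : 'cV[R]_m := delta_mx i 0; pose g := invmx M *m e.
have Mg : M *m g = e by rewrite mulKVmx.
have gM : g^T *m M = e^T by rewrite -{1}Msym -trmx_mul Mg.
have col_i (z : 'cV[R]_m) : (e^T *m z) 0 0 = z i 0.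
  by rewrite trmx_delta -rowE mxE.
have ye : (y^T *m e) 0 0 = y i 0.
  by rewrite -[y^T *m e]trmxK mxE trmx_mul trmxK col_i.
have gi : g i 0 = invmx M i i by rewrite /g -colE mxE.
have quad t : qform M (y - t *: g)
    = qform M y - t * y i 0 *+ 2 + t ^+ 2 * invmx M i i.
  rewrite /qform; have -> : (y - t *: g)^T *m M *m (y - t *: g)
      = y^T *m M *m y - t *: (y^T *m e) - t *: (e^T *m y)
        + t *: (t *: (e^T *m g)).
    have -> : (y - t *: g)^T = y^T - t *: g^T by rewrite raddfB/= linearZ.
    rewrite !mulmxBl !mulmxBr -!scalemxAl -!scalemxAr gM.
    by rewrite -[y^T *m M *m g]mulmxA Mg opprB addrA addrAC.
  move: (ye) (col_i y) (col_i g).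
  set a := y^T *m e; set a' := e^T *m y; set a2 := e^T *m g.
  set a3 := (y^T *m M *m y).
  by rewrite gi !mxE => -> -> ->; ring.
have Nii : 0 < invmx M i i.
  have e0 : e != 0.
    apply/eqP => /matrixP/(_ i 0); rewrite !mxE !eqxx => /eqP.
    by rewrite oner_eq0.
  by have := (posdefmx_inv Mpd).2 e e0; rewrite -mulmxA col_i gi.
have := posdefmx_qform_ge0 (y - (y i 0 / invmx M i i) *: g) Mpd.
rewrite quad; set d := invmx M i i in Nii *; move: (y i 0) (qform M y) => a q.
have -> : q - a / d * a *+ 2 + (a / d) ^+ 2 * d = q - a ^+ 2 / d.
  by field; rewrite gt_eqF.
by rewrite subr_ge0 ler_pdivrMr// mulrC.
Qed.

Lemma posdefmx_lower (R : realType) (m : nat) (M : 'M[R]_m) :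
  posdefmx M -> exists2 c : R, 0 < c & forall y, `|y| ^+ 2 <= c * qform M y.
Proof.
move=> Mpd; exists (1 + \sum_i `|invmx M i i|) => [|y].
  by rewrite ltr_pwDl ?ltr01// sumr_ge0.
have c0 : 0 <= 1 + \sum_i `|invmx M i i| by rewrite addr_ge0 ?sumr_ge0.
have q0 := posdefmx_qform_ge0 y Mpd.
apply: sqr_norm_le => [|i]; first by rewrite mulr_ge0.
rewrite (le_trans (sqr_coord_le_qform y i Mpd))// ler_wpM2r//.
rewrite (bigD1 i)//= addrCA (le_trans (ler_norm _))// lerDl.
by rewrite addr_ge0 ?sumr_ge0.
Qed.

(** All quadratic forms are dominated by a positive definite one. *)
Lemma qform_dominated (R : realType) (m : nat) (M N : 'M[R]_m) :
  posdefmx M -> exists2 c : R, 0 < c & forall y, qform N y <= c * qform M y.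
Proof.
move=> /posdefmx_lower[c c0 cP]; have [d d0 dP] := qform_upper N.
exists (d * c) => [|y]; first exact: mulr_gt0.
by rewrite (le_trans (dP y))// -mulrA ler_pM2l.
Qed.

Lemma qform_block_diag (R : realType) (m1 m2 : nat) (M : 'M[R]_m1)
    (N : 'M[R]_m2) (x : 'cV[R]_m1) (y : 'cV[R]_m2) :
  qform (block_mx M 0 0 N) (col_mx x y) = qform M x + qform N y.
Proof.
rewrite /qform tr_col_mx mul_row_block mul_row_col !mulmx0 addr0 add0r.
by rewrite [LHS]mxE.
Qed.

Lemma qform_diag (R : realType) (m : nat) (d : 'rV[R]_m) (x : 'cV[R]_m) :
  qform (diag_mx d) x = \sum_i d 0 i * x i 0 ^+ 2.
Proof.
rewrite /qform -mulmxA mul_diag_mx mxE; apply: eq_bigr => i _.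
by rewrite !mxE mulrCA expr2.
Qed.

(** For a positive diagonal form, coordinatewise domination of the images under
    its matrix yields domination of the values. *)
Lemma qform_diag_le (R : realType) (m : nat) (D : 'M[R]_m) (p q : 'cV[R]_m) :
  is_diag_mx D -> posdefmx D ->
  (forall i, (D *m p) i 0 ^+ 2 <= (D *m q) i 0 ^+ 2) -> qform D p <= qform D q.
Proof.
move=> /diag_mxP[d ->] Dpd Dpq; rewrite !qform_diag; apply: ler_sum => i _.
have di : qform (diag_mx d) (delta_mx i 0) = d 0 i.
  rewrite qform_diag (bigD1 i)//= big1 => [|j ji].
    by rewrite mxE !eqxx expr1n mulr1 addr0.
  by rewrite mxE (negPf ji) expr0n mulr0.
have d0 : 0 < d 0 i.
  rewrite -di; apply: Dpd.2; apply/eqP => /matrixP/(_ i 0).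
  by rewrite !mxE !eqxx => /eqP; rewrite oner_eq0.
have := Dpq i; rewrite !mul_diag_mx !mxE !exprMn.
by rewrite ler_pM2l ?exprn_gt0// ler_pM2l.
Qed.

(** When [Q *m h = S *m g], each cross term of the block form at [(g, - h)] is
    the opposite of the value of [Q] at [h]. *)
Lemma qform_schur (R : realType) (m : nat) (Q S : 'M[R]_m) (g h : 'cV[R]_m) :
  Q *m h = S *m g ->
  qform (block_mx Q S^T S Q) (col_mx g (- h)) = qform Q g - qform Q h.
Proof.
move=> Qh; rewrite /qform tr_col_mx mul_row_block mul_row_col.
have -> : (- h)^T = - h^T by rewrite raddfN.
have gS : g^T *m S^T *m h = h^T *m Q^T *m h by rewrite -trmx_mul -Qh trmx_mul.
have hQ : (h^T *m Q^T *m h) 0 0 = (h^T *m Q *m h) 0 0.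
  have -> : h^T *m Q^T *m h = (h^T *m Q *m h)^T.
    by rewrite !trmx_mul trmxK mulmxA.
  by rewrite mxE.
rewrite !mulNmx mulmxDl mulNmx -[h^T *m S *m g]mulmxA -Qh mulmxA.
rewrite mulmxN mulmxBl gS opprB addrA subrK.
move: hQ; set a := h^T *m Q^T *m h; set c := h^T *m Q *m h.
by set e := g^T *m Q *m g; rewrite !mxE => ->.
Qed.

(** * A quadratic Lyapunov criterion *)

Lemma lyapunov_asymptotically_stable (R : realType) (m : nat)
    (f : 'cV[R]_m -> 'cV[R]_m) (P : 'M[R]_m) (r : R) :
  posdefmx P -> 0 <= r < 1 -> (forall x, qform P (f x) <= r * qform P x) ->
  asymptotically_stable f 0.
Proof.
move=> Ppd /andP[r0 r1] decr.
have [c c0 lo] := posdefmx_lower Ppd; have [d d0 up] := qform_upper P.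
have iterP x0 k : `|iter k f x0| ^+ 2 <= c * d * r ^+ k * `|x0| ^+ 2.
  have Vk : qform P (iter k f x0) <= r ^+ k * qform P x0.
    elim: k => [|k IH]; first by rewrite expr0 mul1r.
    by rewrite iterS (le_trans (decr _))// exprS -mulrA ler_wpM2l.
  rewrite (le_trans (lo _))// -!mulrA ler_pM2l// (le_trans Vk)//.
  by rewrite mulrCA ler_wpM2l ?exprn_ge0.
have cd0 : 0 < c * d by rewrite mulr_gt0.
have cd1 : 0 < 1 + c * d by rewrite addr_gt0.
split=> [e e0|].
  exists (e / (1 + c * d)) => [|x0]; first exact: divr_gt0.
  rewrite subr0 ltr_pdivlMr// => x0e k; rewrite subr0.
  apply: le_lt_trans x0e.
  rewrite -ler_sqr ?nnegrE ?mulr_ge0 ?(ltW cd1)//.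
  rewrite (le_trans (iterP x0 k))// exprMn mulrC ler_wpM2l ?sqr_ge0//.
  apply: (@le_trans _ _ (c * d)); last by nra.
  by rewrite ler_piMr ?(ltW cd0)// exprn_ile1// ltW.
exists 1 => // x0 _; apply/cvgr0Pnorm_lt => e e0.
have rk : c * d * `|x0| ^+ 2 * r ^+ k @[k --> \oo] --> (0 : R).
  rewrite -(mulr0 (c * d * `|x0| ^+ 2)); apply: cvgM; first exact: cvg_cst.
  by apply: cvg_expr; rewrite ger0_norm.
have e2 : 0 < e ^+ 2 by rewrite exprn_gt0.
near=> k; rewrite -ltr_sqr ?nnegrE ?(ltW e0)//.
apply: le_lt_trans (iterP x0 k) _; rewrite mulrAC.
apply: le_lt_trans (ler_norm _) _; near: k.
by move/cvgr0Pnorm_lt : rk; apply.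
Unshelve. all: by end_near. Qed.

(** * The network as a linear map in feedback with the activations *)

(** Block row [i] of [Nvw] applied to a stack. The row [i = 0] vanishes, which
    agrees with the right-hand side only because [z 0 = 0]. *)
Lemma mxcol_subdiag (R : realType) (n : nat -> nat) (l : nat)
    (W : forall i, 'M[R]_(n i.+1, n i)) (i : 'I_l)
    (z : forall j, 'cV[R]_(n j)) :
  z 0%N = 0 ->
  \sum_(j < l) (if i == j.+1 :> nat then conform_mx 0 (W i)
                else 0 : 'M[R]_(n i.+1, n j.+1)) *m z j.+1 = W i *m z i.
Proof.
move=> z0; case: i => [[|k] ki] /=.
  by rewrite z0 mulmx0 big1// => j _; rewrite mul0mx.
rewrite (bigD1 (Ordinal (ltnW ki)))//= eqxx conform_mx_id big1 ?addr0// => j jk.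
rewrite eqSS ifN ?mul0mx// eq_sym; apply: contra jk => /eqP jk.
exact/eqP/val_inj.
Qed.

Lemma Nvw_mul (R : realType) (n : nat -> nat) (l : nat)
    (W : forall i, 'M[R]_(n i.+1, n i)) (z : forall j, 'cV[R]_(n j)) :
  z 0%N = 0 ->
  Nvw l W *m \mxcol_(j < l) z j.+1 = \mxcol_(i < l) (W i *m z i).
Proof.
move=> z0; rewrite /Nvw mul_mxblock_mxrow; apply: eq_mxcol => i.
exact: mxcol_subdiag.
Qed.

Lemma map_stacked_in (R : realType) (n : nat -> nat) (l : nat) (phi : R -> R)
    (W : forall i, 'M[R]_(n i.+1, n i)) (b : forall i, 'cV[R]_(n i.+1))
    (x : 'cV[R]_(n 0%N)) :
  map_mx phi (stacked_in l phi W b x)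
  = \mxcol_(i < l) layer_out phi W b x i.+1.
Proof. by apply/matrixP => i j; rewrite !mxE. Qed.

Lemma stacked_in_sub (R : realType) (n : nat -> nat) (l : nat) (phi : R -> R)
    (W : forall i, 'M[R]_(n i.+1, n i)) (b : forall i, 'cV[R]_(n i.+1))
    (x y : 'cV[R]_(n 0%N)) :
  stacked_in l phi W b x - stacked_in l phi W b y
  = Nvx l W *m (x - y)
    + Nvw l W *m (map_mx phi (stacked_in l phi W b x)
                  - map_mx phi (stacked_in l phi W b y)).
Proof.
rewrite !map_stacked_in /stacked_in -!mxcolB.
(* The stack starts at layer 1, so the entry at index 0 of the family can be
   chosen freely; the value 0 accounts for the absent input column of [Nvw]. *)
pose z j : 'cV[R]_(n j) :=
  if j is 0%N then 0 else layer_out phi W b x j - layer_out phi W b y j.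
rewrite -[X in _ + _ *m X]/(\mxcol_(j < l) z j.+1) Nvw_mul// /Nvx mxcol_mul.
rewrite -mxcolD; apply: eq_mxcol => -[[|k] ki] /=; rewrite /layer_in.
  by rewrite conform_mx_id mulmx0 addr0 mulmxBr opprD addrACA subrr addr0.
by rewrite mul0mx add0r mulmxBr opprD addrACA subrr addr0.
Qed.

Lemma network_sub (R : realType) (n : nat -> nat) (l : nat) (phi : R -> R)
    (W : forall i, 'M[R]_(n i.+1, n i)) (b : forall i, 'cV[R]_(n i.+1))
    (x y : 'cV[R]_(n 0%N)) :
  (0 < l)%N ->
  network l phi W b x - network l phi W b y
  = Nuw l W *m (map_mx phi (stacked_in l phi W b x)
                - map_mx phi (stacked_in l phi W b y)).
Proof.
case: l => // l _; rewrite !map_stacked_in -mxcolB /Nuw mul_mxrow_mxcol.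
rewrite (bigD1 ord_max)//= eqxx conform_mx_id big1 ?addr0 => [|j jl].
  by rewrite /network /layer_in opprD addrACA subrr addr0 -mulmxBr.
rewrite eqSS ifN ?mul0mx//; apply: contra jl => /eqP jl; exact/eqP/val_inj.
Qed.

(** [Nvw] only feeds layer [i] from layer [i - 1] and a diagonal factor keeps
    the layers apart, so a fixed vector vanishes layer after layer. *)
Lemma loop_unitmx (R : realType) (n : nat -> nat) (l : nat)
    (W : forall i, 'M[R]_(n i.+1, n i)) (d : 'rV[R]_(nphi n l)) :
  1%:M - Nvw l W *m diag_mx d \in unitmx.
Proof.
rewrite -unitmx_tr -row_free_unit; apply: inj_row_free => v0 v0K.
suff fixed0 (v : 'cV_(nphi n l)) : v = Nvw l W *m (diag_mx d *m v) -> v = 0.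
  apply: trmx_inj; rewrite trmx0; apply: fixed0; apply/eqP; rewrite -subr_eq0.
  rewrite mulmxA -{1}[v0^T]mul1mx -mulmxBl -[X in X *m _]trmxK -trmx_mul.
  by rewrite v0K trmx0.
move=> vE; apply/mxcolP => i; rewrite submxcol0.
case: i => i; elim: i => [|i IH] il; rewrite vE /Nvw -[diag_mx d *m v]submxcolK.
  rewrite mul_mxblock_mxrow mxcolK big1// => j _.
  by rewrite mul0mx.
rewrite mul_mxblock_mxrow mxcolK big1// => j _ /=.
case: eqP => [[ij]|_]; last by rewrite mul0mx.
suff -> : submxcol (diag_mx d *m v) j = 0 by rewrite mulmx0.
have vj : submxcol v j = 0.
  by case: j ij => j jl ij; rewrite /= in ij; subst i; exact: IH.
apply/matrixP => p q; move/matrixP/(_ p q): vj.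
by rewrite mul_diag_mx !mxE => ->; rewrite mulr0.
Qed.

(** * The sector condition as a norm bound *)

(** Subtracting the mean slope and dividing by half the width [b - a] turns the
    sector [[a, b]] into [[- 1, 1]]. When [a = b] the sector forces
    [phi nu - phi nu0 = a * (nu - nu0)], and [z = 0]. *)
Lemma offset_sector_normalized (R : realType) (phi : R -> R) (a b nu0 nu : R) :
  offset_sector phi a b nu0 ->
  exists z, phi nu - phi nu0 = (b - a) / 2 * z + (a + b) / 2 * (nu - nu0)
            /\ z ^+ 2 <= (nu - nu0) ^+ 2.
Proof.
move=> /(_ nu); move: (phi nu) (phi nu0) => w w0; set dv := nu - nu0.
have -> : nu0 - nu = - dv by rewrite opprB.
move=> sec; have [ab|ab] := eqVneq a b.
  exists 0; split; last by rewrite expr0n sqr_ge0.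
  suff : (w - w0 - a * dv) ^+ 2 <= 0.
    rewrite -ab le_eqVlt ltNge sqr_ge0 orbF sqrf_eq0 subr_eq0 => /eqP ->.
    by field.
  by move: sec; rewrite -ab; nra.
have ba : b - a != 0 by rewrite subr_eq0 eq_sym.
exists ((2 * (w - w0) - (a + b) * dv) / (b - a)); split; first by field.
rewrite exprMn exprVn ler_pdivrMr; last first.
  by rewrite lt_neqAle sqr_ge0 eq_sym sqrf_eq0 ba.
by move: sec; nra.
Qed.

Lemma elementwise_sector_normalized (R : realType) (m : nat) (phi : R -> R)
    (alpha beta vs v : 'cV[R]_m) :
  elementwise_offset_sector phi alpha beta vs ->
  exists z : 'cV[R]_m,
    map_mx phi v - map_mx phi vs
    = half_diff alpha beta *m z + half_sum alpha beta *m (v - vs)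
    /\ forall i, z i 0 ^+ 2 <= (v - vs) i 0 ^+ 2.
Proof.
move=> sec.
have /choice[z zP] i := offset_sector_normalized (v i 0) (sec i).
exists (\col_i z i); split=> [|i]; last by rewrite !mxE (zP i).2.
apply/matrixP => i j; rewrite /half_diff /half_sum -!scalemxAl mulmxBl mulmxDl.
by rewrite !mul_diag_mx !mxE (ord1 j) (zP i).1; field.
Qed.

Lemma half_sum_diag (R : realType) (m : nat) (alpha beta : 'cV[R]_m) :
  half_sum alpha beta = diag_mx (2^-1 *: (alpha + beta)^T).
Proof. by apply/matrixP => i j; rewrite !mxE -mulrnDl -mulrnAr. Qed.

(** The activations are eliminated in favour of a signal [z] bounded, coordinate
    by coordinate, by the deviation [dv] of the pre-activations. *)
Lemma loop_transformation (R : realType) (n : nat -> nat) (l : nat)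
    (phi : R -> R) (W : forall i, 'M[R]_(n i.+1, n i))
    (b : forall i, 'cV[R]_(n i.+1)) (alpha beta : 'cV[R]_(nphi n l))
    (x y : 'cV[R]_(n 0%N)) :
  (0 < l)%N ->
  elementwise_offset_sector phi alpha beta (stacked_in l phi W b y) ->
  exists z dv : 'cV[R]_(nphi n l),
    [/\ dv = Nvx_t W alpha beta *m (x - y) + Nvz_t W alpha beta *m z,
        network l phi W b x - network l phi W b y
        = Nux_t W alpha beta *m (x - y) + Nuz_t W alpha beta *m z
      & forall i, z i 0 ^+ 2 <= dv i 0 ^+ 2].
Proof.
move=> l0 /(elementwise_sector_normalized (stacked_in l phi W b x))[z []].
have := network_sub phi W b x y l0; have := stacked_in_sub l phi W b x y.
set dv := stacked_in _ _ _ _ x - _; set dw := _ - map_mx _ _.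
move=> dvE -> dwE zdv; exists z, dv.
have unit4 : 1%:M - C4 W alpha beta \in unitmx.
  by rewrite /C4 half_sum_diag loop_unitmx.
have dv_t : dv = Nvx_t W alpha beta *m (x - y) + Nvz_t W alpha beta *m z.
  rewrite /Nvx_t /Nvz_t -!mulmxA -mulmxDr; apply: (can_inj (mulKmx unit4)).
  rewrite mulKVmx// mulmxBl mul1mx {1}dvE dwE /C3 /C4 mulmxDr !mulmxA.
  by rewrite addrA addrK.
split=> //; rewrite dwE /Nux_t /Nuz_t /Nux add0r mulmxDl addrCA.
rewrite mulmxDr /C1 !mulmxA; congr (_ + _).
by rewrite -/(C2 W alpha beta) dv_t mulmxDr /Nvx_t /Nvz_t !mulmxA.
Qed.

(** * From the LMI to a contraction of the Lyapunov function *)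

Lemma qform_invmx (R : realType) (m : nat) (M : 'M[R]_m) (x : 'cV[R]_m) :
  posdefmx M -> qform M (invmx M *m x) = qform (invmx M) x.
Proof.
move=> Mpd; rewrite qform_mul; congr (qform _ x).
by rewrite (posdefmx_inv Mpd).1 mulVmx ?mul1mx// posdefmx_unit.
Qed.

(** The LMI is tested at [(Q1^-1 x, Q2^-1 z, - Q1^-1 x', - Q2^-1 v)]. Its
    value there is the decrease of [Q1^-1] from [x] to [x'] plus the decrease of
    [Q2^-1] from [z] to [v], which is nonpositive. The rate [r] does not depend
    on the vectors because the LMI dominates the form [Q1] of the first block. *)
Lemma lmi_contraction (R : realType) (m k : nat) (Q1 : 'M[R]_m) (Q2 : 'M[R]_k)
    (S11 : 'M[R]_m) (S12 : 'M[R]_(m, k)) (S21 : 'M[R]_(k, m)) (S22 : 'M[R]_k) :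
  posdefmx Q1 -> is_diag_mx Q2 -> posdefmx Q2 ->
  posdefmx (block_mx (block_mx Q1 0 0 Q2) (block_mx S11 S12 S21 S22)^T
                     (block_mx S11 S12 S21 S22) (block_mx Q1 0 0 Q2)) ->
  exists2 r : R, 0 <= r < 1 & forall (x x' : 'cV[R]_m) (z v : 'cV[R]_k),
    x' = S11 *m (invmx Q1 *m x) + S12 *m (invmx Q2 *m z) ->
    v = S21 *m (invmx Q1 *m x) + S22 *m (invmx Q2 *m z) ->
    (forall i, z i 0 ^+ 2 <= v i 0 ^+ 2) ->
    qform (invmx Q1) x' <= r * qform (invmx Q1) x.
Proof.
move=> Q1pd Q2diag Q2pd Mpd.
have [c c0 cP] := qform_dominated (block_mx (block_mx Q1 0 0 0) 0 0 0) Mpd.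
exists (c / (1 + c)) => [|x x' z v x'E vE zv].
  by rewrite divr_ge0 ?ltr_pdivrMr ?mul1r ?ltrDr ?ltr01 ?addr_ge0 ?addr_gt0 ?ltW.
have Q1u := posdefmx_unit Q1pd; have Q2u := posdefmx_unit Q2pd.
pose g := col_mx (invmx Q1 *m x) (invmx Q2 *m z).
pose h := col_mx (invmx Q1 *m x') (invmx Q2 *m v).
have Qh : block_mx Q1 0 0 Q2 *m h = block_mx S11 S12 S21 S22 *m g.
  rewrite !mul_block_col !mul0mx addr0 add0r !mulKVmx//.
  by rewrite -x'E -vE.
have form0 j (y : 'cV[R]_j) : qform 0 y = 0 by rewrite /qform mulmx0 mul0mx mxE.
have := cP (col_mx g (- h)); rewrite (qform_schur Qh) /g /h !qform_block_diag.
rewrite !form0 !addr0.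
have : qform Q2 (invmx Q2 *m z) <= qform Q2 (invmx Q2 *m v).
  by apply: qform_diag_le => // i; rewrite !mulKVmx.
rewrite !(qform_invmx _ Q1pd).
set V := qform _ x; set V' := qform _ x'; set a := qform _ _; set a' := qform _ _.
have V0 : 0 <= V by apply: posdefmx_qform_ge0; exact: posdefmx_inv.
move=> aa' VV'.
have {VV'} dec : V <= c * (V - V').
  by apply: le_trans VV' _; rewrite ler_pM2l//; lra.
have V'V : V' <= V by rewrite -subr_ge0 -(pmulr_rge0 _ c0) (le_trans V0).
by rewrite mulrAC ler_pdivlMr ?addr_gt0//; lra.
Qed.

Lemma data_mx_step (R : realType) (m p : nat) (A : 'M[R]_m) (B : 'M[R]_(m, p))
    (K : nat) (u : nat -> 'cV[R]_p) (x : nat -> 'cV[R]_m) :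
  (forall k, (k < K)%N -> x k.+1 = A *m x k + B *m u k) ->
  data_mx x 1 K = A *m data_mx x 0 K + B *m data_mx u 0 K.
Proof.
move=> step; apply/matrixP => i j; rewrite !mxE add1n step// !mxE.
by congr (_ + _); apply: eq_bigr => q _; rewrite !mxE.
Qed.

Theorem theorem4 (R : realType)
    (* controller: l hidden layers, n_x = n 0, n_u = n l.+1 *)
    (l : nat) (hl : (0 < l)%N) (n : nat -> nat) (phi : R -> R)
    (W : forall i, 'M[R]_(n i.+1, n i)) (b : forall i, 'cV[R]_(n i.+1))
    (hpi0 : network l phi W b 0 = 0)
    (* plant and data *)
    (A : 'M[R]_(n 0%N)) (B : 'M[R]_(n 0%N, n l.+1))
    (K : nat) (u : nat -> 'cV[R]_(n l.+1)) (x : nat -> 'cV[R]_(n 0%N))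
    (hdata : forall k, (k < K)%N -> x k.+1 = A *m x k + B *m u k)
    (U0 : 'M[R]_(n l.+1, K)) (hU0 : U0 = data_mx u 0 K)
    (X0 : 'M[R]_(n 0%N, K)) (hX0 : X0 = data_mx x 0 K)
    (X1 : 'M[R]_(n 0%N, K)) (hX1 : X1 = data_mx x 1 K)
    (hrank0 : \rank (col_mx U0 X0) = (n 0 + n l.+1)%N)
    (hrank1 : \rank X1 = n 0%N)
    (* offset sector centred on the activations at the equilibrium x_* = 0 *)
    (alpha beta vs : 'cV[R]_(nphi n l))
    (hab : forall i, alpha i 0 <= beta i 0)
    (hvs : vs = stacked_in l phi W b 0)
    (hsector : elementwise_offset_sector phi alpha beta vs)
    (* LMI and data equations *)
    (hLMI : exists (L1 : 'M[R]_(K, n 0%N)) (L2 : 'M[R]_(K, nphi n l))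
        (Q1 : 'M[R]_(n 0%N)) (Q2 : 'M[R]_(nphi n l)),
      let Nux' := Nux_t W alpha beta in
      let Nuz' := Nuz_t W alpha beta in
      let Nvx' := Nvx_t W alpha beta in
      let Nvz' := Nvz_t W alpha beta in
      [/\ posdefmx Q1,
          is_diag_mx Q2 /\ posdefmx Q2,
          posdefmx (block_mx
            (block_mx Q1 0
                      0  Q2)
            (block_mx (L1^T *m X1^T) (Q1 *m Nvx'^T)
                      (L2^T *m X1^T) (Q2 *m Nvz'^T))
            (block_mx (X1 *m L1)   (X1 *m L2)
                      (Nvx' *m Q1) (Nvz' *m Q2))
            (block_mx Q1 0
                      0  Q2)),
          col_mx (Nux' *m Q1) Q1 = col_mx U0 X0 *m L1 &
          col_mx (Nuz' *m Q2) 0 = col_mx U0 X0 *m L2]) :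
  asymptotically_stable
    (fun xi : 'cV[R]_(n 0%N) => A *m xi + B *m network l phi W b xi) 0.
Proof.
case: hLMI => L1 [L2 [Q1 [Q2 /= [Q1pd [Q2diag Q2pd] lmi eq1 eq2]]]].
have Q1u := posdefmx_unit Q1pd; have Q2u := posdefmx_unit Q2pd.
(* The columns of [L1] and [L2] combine the data into the closed-loop maps. *)
have X1E : X1 = A *m X0 + B *m U0 by rewrite hX1 hX0 hU0; exact: data_mx_step.
move: eq1 eq2; rewrite !mul_col_mx => /eq_col_mx[u1 x1] /eq_col_mx[u2 x2].
have XL1 : X1 *m L1 = (A + B *m Nux_t W alpha beta) *m Q1.
  by rewrite X1E !mulmxDl -!mulmxA -u1 -x1.
have XL2 : X1 *m L2 = B *m Nuz_t W alpha beta *m Q2.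
  by rewrite X1E !mulmxDl -!mulmxA -u2 -x2 mulmx0 add0r.
have [|r r01 contr] := @lmi_contraction _ _ _ Q1 Q2 (X1 *m L1) (X1 *m L2)
    (Nvx_t W alpha beta *m Q1) (Nvz_t W alpha beta *m Q2) Q1pd Q2diag Q2pd.
  rewrite tr_block_mx !(trmx_mul X1) (trmx_mul (Nvx_t _ _ _)).
  by rewrite (trmx_mul (Nvz_t _ _ _)) Q1pd.1 Q2pd.1.
apply: (lyapunov_asymptotically_stable (posdefmx_inv Q1pd) r01) => xi.
move: hsector; rewrite hvs => /(loop_transformation xi hl)[z [dv []]].
rewrite hpi0 !subr0 => dvE piE zdv.
apply: contr zdv; last by rewrite -!(mulmxA _ Q1) -!(mulmxA _ Q2) !mulKVmx.
rewrite piE XL1 XL2 -!(mulmxA _ Q1) -!(mulmxA _ Q2) !mulKVmx//.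
move: (Nux_t W alpha beta) (Nuz_t W alpha beta) => N1 N2.
by rewrite mulmxDr mulmxDl addrA !mulmxA.
Qed.
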